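(* Let $K$ be a field, $S=K[x_1,\dots,x_n]$, $\mathfrak{m}=(x_1,\dots,x_n)$, and let $I,J\subset S$ be polymatroidal ideals such that $\mathfrak{m}\in\mathrm{Ass}(I)$. Then $(IJ)^{(k)}=(IJ)^k$ for all $k\ge1$.
   Context: $\mathrm{Ass}(L)$ is the set of associated primes of $S/L$, and the $k$th symbolic power is $L^{(k)}=\bigcap_{P\in\mathrm{Ass}(L)}(L^kS_P\cap S)$. Let $\mathcal{G}(I)$ be the minimal monomial generating set of a monomial ideal $I$ and $\deg_{x_i}(u)$ the exponent of $x_i$ in a monomial $u$. A nonzero monomial ideal $I$ is *polymatroidal* if it is generated in a single degree and for all $u,v\in\mathcal{G}(I)$ and every $i$ with $\deg_{x_i}(u)>\deg_{x_i}(v)$ there is $j$ with $\deg_{x_j}(u)<\deg_{x_j}(v)$ and $x_j(u/x_i)\in\mathcal{G}(I)$. *)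

(* Defs.v *)
From HB Require Import structures.
From mathcomp Require Import all_boot all_order all_algebra.
From mathcomp Require Import boolp classical_sets.
From mathcomp Require Import mpoly.

Set Implicit Arguments.
Unset Strict Implicit.
Unset Printing Implicit Defensive.

Import GRing.Theory.

Local Open Scope classical_set_scope.
Local Open Scope ring_scope.

(* The ideals of ring_quotient are proper and boolean; here ideals are        *)
(* arbitrary sets and the unit ideal is allowed.                              *)

Section Ideals.
Context {R : comNzRingType}.
Implicit Types (A I J L P : set R).

Definition is_ideal I : Prop :=
  [/\ I 0, forall x y, I x -> I y -> I (x + y) & forall a x, I x -> I (a * x)].

Definition is_prime_ideal P : Prop :=
  [/\ is_ideal P, ~ P 1 & forall x y, P (x * y) -> P x \/ P y].

Definition ideal_gen A : set R := smallest is_ideal A.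

Definition ideal_mul I J : set R := ideal_gen [set x * y | x in I & y in J].

Definition ideal_exp I (k : nat) : set R := iter k (ideal_mul I) setT.

(* The set on the right is the annihilator of the class of f in R / L. *)
Definition Ass L : set (set R) :=
  [set P | is_prime_ideal P /\ exists f, P = [set g | L (g * f)]].

End Ideals.

Section SymbolicPower.
Context {R : idomainType}.
Implicit Types (I L P : set R).

(* R_P as a subring of the fraction field. *)
Definition loc_ring P : set {fraction R} :=
  [set z | exists a s, ~ P s /\ z = tofrac a / tofrac s].

(* M is closed under the operations of an R_P-submodule of Frac(R). *)
Definition loc_submod P (M : set {fraction R}) : Prop :=
  [/\ M 0, forall x y, M x -> M y -> M (x + y)
    & forall a x, loc_ring P a -> M x -> M (a * x)].

(* I R_P *)
Definition loc_ideal P I : set {fraction R} :=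
  smallest (loc_submod P) [set tofrac x | x in I].

Definition symbolic_power L (k : nat) : set R :=
  \bigcap_(P in Ass L) (@tofrac R @^-1` loc_ideal P (ideal_exp L k)).

End SymbolicPower.

Section Polymatroidal.
Context {K : fieldType} {n : nat}.
Implicit Types (I : set {mpoly K[n]}) (G : set 'X_{1..n}).

Definition max_ideal : set {mpoly K[n]} :=
  ideal_gen [set f | exists i : 'I_n, f = 'X_i].

(* Monomials are represented by their exponent vectors. *)
Definition monomial_ideal G : set {mpoly K[n]} :=
  ideal_gen [set 'X_[u] | u in G].

Definition minimal_generators I G : Prop :=
  I = monomial_ideal G /\
  forall G', G' `<=` G -> I = monomial_ideal G' -> G' = G.

(* A monomial ideal has exactly one minimal set G of monomial generators. *)
Definition polymatroidal I : Prop :=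
  I <> [set 0] /\
  exists G : set 'X_{1..n},
    [/\ minimal_generators I G,
        exists d, forall u, G u -> mdeg u = d
      & forall u v, G u -> G v -> forall i : 'I_n, (v i < u i)%N ->
          exists j : 'I_n, (u j < v j)%N /\ G (u - U_(i) + U_(j))%MM].

End Polymatroidal.

Arguments max_ideal K n : clear implicits.

(* Main.v *)
Require Import Defs.
From mathcomp Require Import all_boot all_order all_algebra.
From mathcomp Require Import boolp classical_sets.
From mathcomp Require Import mpoly.
From mathcomp Require Import zify.

(** Write L = IJ. Since the maximal ideal m is associated to I, there is a
    monomial w outside I all of whose multiples [w x_i] lie in I. The exchange
    property allows w to be replaced by one of its divisors u whose degree is
    one less than the degree of the generators of I, so that every [u x_i] is
    itself a generator of I ([polymatroidal_socle]). If v is a generator of J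
    then [u v x_i] lies in L for all i, whereas [u v] does not, its degree
    being smaller than that of the generators of L. So m annihilates the
    class of [u v], and nothing outside m does, because a polynomial with
    nonzero constant term is a nonzerodivisor modulo any monomial ideal
    ([monomial_ideal_cancel]). Hence m is associated to L
    ([Ass_max_ideal_mul]).

    Therefore the k-th symbolic power of L is contained in the contraction of
    [L^k S_m] ([symbolic_power_id]), which is [L^k] by the same cancellation
    property, applied this time to the monomial ideal [L^k]. *)

Set Implicit Arguments.
Unset Strict Implicit.
Unset Printing Implicit Defensive.

Import GRing.Theory.

Local Open Scope classical_set_scope.
Local Open Scope ring_scope.

(** * Ideals and symbolic powers *)

Section IdealTheory.
Context {R : comNzRingType}.
Implicit Types (A I J L : set R).

Lemma ideal_gen_is_ideal A : is_ideal (ideal_gen A).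
Proof.
split=> [I [[]] //|x y Ax Ay I hI|a x Ax I hI]; case: (hI) => -[_ addI mulI] _.
  by apply: addI; [apply: Ax|apply: Ay].
by apply: mulI; apply: Ax.
Qed.

Lemma ideal_gen_sub A I : is_ideal I -> A `<=` I -> ideal_gen A `<=` I.
Proof. exact: smallest_sub. Qed.

Lemma sub_ideal_gen A : A `<=` ideal_gen A.
Proof. exact: sub_gen_smallest. Qed.

Lemma is_ideal_setT : is_ideal (@setT R).
Proof. by split. Qed.

Lemma ideal_mul_mem I J x y : I x -> J y -> ideal_mul I J (x * y).
Proof. by move=> Ix Jy; apply: sub_ideal_gen; exists x => //; exists y. Qed.

Lemma ideal_exp_is_ideal L k : is_ideal (ideal_exp L k).
Proof.
by case: k => [|k]; [exact: is_ideal_setT|exact: ideal_gen_is_ideal].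
Qed.

Lemma is_ideal_colon L f : is_ideal L -> is_ideal [set g | L (g * f)].
Proof.
case=> L0 LD LM; split=> [|x y|a x] /=; first by rewrite mul0r.
  by rewrite mulrDl; apply: LD.
by rewrite -mulrA; apply: LM.
Qed.

Lemma is_ideal_sum L (T : eqType) (r : seq T) (F : T -> R) :
  is_ideal L -> (forall i, i \in r -> L (F i)) -> L (\sum_(i <- r) F i).
Proof.
case=> L0 LD LM; elim: r => [|i r IHr] LF; first by rewrite big_nil.
rewrite big_cons; apply: LD; first by apply: LF; rewrite mem_head.
by apply: IHr => j jr; apply: LF; rewrite in_cons jr orbT.
Qed.

End IdealTheory.

(** Every element of [I R_P] is a fraction a / s with a in I and s outside P:
    such fractions form a module over [R_P]. *)
Lemma loc_idealP (R : idomainType) (P I : set R) x :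
    is_prime_ideal P -> is_ideal I -> loc_ideal P I (tofrac x) ->
  exists2 s, ~ P s & I (s * x).
Proof.
move=> [[P0 PD PM] P1 Pprime] [I0 ID IM].
have s0 s : ~ P s -> tofrac s != 0.
  by move=> Ps; rewrite tofrac_eq0; apply/eqP => s0; apply: Ps; rewrite s0.
have PsM s t : ~ P s -> ~ P t -> ~ P (s * t) by move=> Ps Pt /Pprime[].
pose M := [set z : {fraction R} |
  exists a s, [/\ I a, ~ P s & z = tofrac a / tofrac s]].
have subM : loc_ideal P I `<=` M.
  apply: smallest_sub; last first.
    by move=> _ [a Ia <-]; exists a, 1; split=> //; rewrite tofrac1 divr1.
  split.
  - by exists 0, 1; split=> //; rewrite tofrac0 mul0r.
  - move=> _ _ [a [s [Ia Ps ->]]] [b [t [Ib Pt ->]]].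
    exists (t * a + s * b), (s * t); split.
    + by apply: ID; apply: IM.
    + exact: PsM.
    + by rewrite addf_div ?s0 // -!tofracM -tofracD (mulrC a) (mulrC b).
  - move=> _ _ [b [t [Pt ->]]] [a [s [Ia Ps ->]]].
    exists (b * a), (t * s); split; [exact: IM|exact: PsM|].
    by rewrite !tofracM mulf_div.
move=> /subM[a [s [Ia Ps /eqP]]].
rewrite eq_sym -(inj_eq (mulIf (s0 _ Ps))) divfK ?s0 //.
by rewrite -tofracM tofrac_eq mulrC => /eqP as_eq; exists s; rewrite -?as_eq.
Qed.

(** Only the component at a single associated prime P matters as soon as
    [L^k R_P] contracts to [L^k]. *)
Lemma symbolic_power_id (R : idomainType) (L P : set R) k :
    Ass L P ->
    (forall s f, ~ P s -> ideal_exp L k (s * f) -> ideal_exp L k f) ->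
  symbolic_power L k = ideal_exp L k.
Proof.
move=> AssP cancelP; apply/seteqP; split=> [f symf|f Lf Q _]; last first.
  by apply: sub_gen_smallest; exists f.
case: (AssP) => primeP _.
have [s Ps] := loc_idealP primeP (ideal_exp_is_ideal L k) (symf P AssP).
exact: cancelP.
Qed.

(** * Monomial ideals *)

Section MonomialIdeals.
Context {K : fieldType} {n : nat}.
Implicit Types (G H : set 'X_{1..n}).

Lemma monomial_idealP G f :
  monomial_ideal (K := K) G f <->
  forall m, m \in msupp f -> exists2 u, G u & (u <= m)%MM.
Proof.
split; last first.
  move=> Gf; rewrite (mpolyE f); apply: (is_ideal_sum (ideal_gen_is_ideal _)).
  have [_ _ GM] := @ideal_gen_is_ideal {mpoly K[n]} [set 'X_[u] | u in G].
  move=> m /Gf[u Gu /submK <-]; rewrite mpolyXD -mul_mpolyC mulrA.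
  by apply: GM; apply: sub_ideal_gen; exists u.
move: f; apply: ideal_gen_sub; last first.
  move=> _ [u Gu <-] m; rewrite msuppX inE => /eqP ->.
  by exists u => //; apply: lepm_refl.
split=> [m|f g Gf Gg m /msuppD_le|a f Gf m /msuppM_le].
- by rewrite msupp0.
- by rewrite mem_cat => /orP[/Gf|/Gg].
- case/allpairsP=> -[m1 m2] /= [_ /Gf[u Gu um2] ->]; exists u => //.
  exact: lepm_trans um2 (lem_addl _ _).
Qed.

Lemma monomial_idealX G m :
  monomial_ideal (K := K) G 'X_[m] <-> exists2 u, G u & (u <= m)%MM.
Proof.
rewrite monomial_idealP; split; first by apply; rewrite msuppX mem_head.
by move=> Gm m'; rewrite msuppX inE => /eqP ->.
Qed.

Lemma ideal_mul_monomial G H :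
  ideal_mul (monomial_ideal (K := K) G) (monomial_ideal H) =
  monomial_ideal [set (u + v)%MM | u in G & v in H].
Proof.
apply/seteqP; split; apply: ideal_gen_sub; try exact: ideal_gen_is_ideal.
  move=> _ [f /monomial_idealP Gf [g /monomial_idealP Hg <-]].
  apply/monomial_idealP => _ /msuppM_le /allpairsP[[m1 m2] /= [m1f m2g ->]].
  have [[u Gu /mnm_lepP um1] [v Hv /mnm_lepP vm2]] := (Gf _ m1f, Hg _ m2g).
  exists (u + v)%MM; first by exists u => //; exists v.
  by apply/mnm_lepP => i; rewrite !mnmDE leq_add.
move=> _ [_ [u Gu [v Hv <-]] <-]; rewrite mpolyXD.
by apply: ideal_mul_mem; apply: sub_ideal_gen; [exists u|exists v].
Qed.

Lemma ideal_exp_monomial G k :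
  exists H, ideal_exp (monomial_ideal (K := K) G) k = monomial_ideal H.
Proof.
elim: k => [|k [H eH]]; last first.
  by eexists; rewrite /ideal_exp iterS -/(ideal_exp _ k) eH ideal_mul_monomial.
exists [set 0%MM]; apply/seteqP; split=> // f _.
apply/monomial_idealP => m _; exists 0%MM => //.
by apply/mnm_lepP => i; rewrite mnm0E.
Qed.

Lemma max_idealE :
  max_ideal K n = monomial_ideal [set u | exists i : 'I_n, u = U_(i)%MM].
Proof.
congr ideal_gen; apply/seteqP; split=> [_ [i ->]|_ [_ [i ->] <-]].
  by exists U_(i)%MM => //; exists i.
by exists i.
Qed.

Lemma max_ideal_coeff0 (f : {mpoly K[n]}) : max_ideal K n f <-> f@_0%MM = 0.
Proof.
rewrite max_idealE monomial_idealP; split=> [suppf|f0 m mf].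
  apply/eqP; rewrite mcoeff_eq0; apply/negP => /suppf[_ [i ->]].
  by move=> /mnm_lepP/(_ i); rewrite mnm1E mnm0E eqxx.
have : (m != 0)%MM.
  by apply: contraTneq mf => ->; rewrite mcoeff_msupp f0 eqxx.
rewrite -mdeg_eq0 mdegE sum_nat_eq0 => /forallPn[i]; rewrite -lt0n => mi.
exists U_(i)%MM; first by exists i.
by apply/mnm_lepP => j; rewrite mnm1E; case: eqP => // <-.
Qed.

(** A polynomial s with nonzero constant term c is a nonzerodivisor modulo a
    monomial ideal. Writing [c f = s f - (s - c) f], each monomial of f either
    occurs in [s f] or is a proper multiple of another monomial of f, so that
    induction on the degree shows that all of them lie in the ideal. *)
Lemma monomial_ideal_cancel G s f :
  ~ max_ideal K n s -> monomial_ideal G (s * f) -> monomial_ideal G f.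
Proof.
rewrite max_ideal_coeff0 => /eqP c0 /monomial_idealP Gsf.
apply/monomial_idealP => m; have [d] := ubnP (mdeg m).
elim: d m => // d IHd m; rewrite ltnS => md mf.
set c := s@_0%MM in c0; pose t := s - c%:MP.
have t0 : t@_0%MM = 0 by rewrite mcoeffB mcoeffC eqxx mulr1 subrr.
have : m \in msupp (s * f - t * f).
  rewrite -mulrBl opprB addrC subrK mcoeff_msupp mcoeffCM mulf_neq0 //.
  by rewrite -mcoeff_msupp.
move=> /msuppB_le; rewrite mem_cat => /orP[/Gsf //|/msuppM_le].
case/allpairsP=> -[m1 m2] /= [m1t m2f em].
have m1_gt0 : (0 < mdeg m1)%N.
  rewrite lt0n mdeg_eq0; apply: contraTneq m1t => ->.
  by rewrite mcoeff_msupp t0 eqxx.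
have [|u Gu um2] := IHd m2 _ m2f.
  by apply: leq_trans md; rewrite em mdegD -[X in (X < _)%N]add0n ltn_add2r.
by exists u => //; rewrite em; exact: lepm_trans um2 (lem_addl _ _).
Qed.

(** * The socle of a polymatroidal ideal *)

(** The divisor u of w is [g / x_i0], where g is a generator dividing
    [w x_i0]. For another index i, take a generator v dividing [w x_i] and
    exchange [x_i0] in g against v: the outcome [u x_j] would divide w unless
    [j = i]. *)
Lemma polymatroid_socle G (w : 'X_{1..n}) (i0 : 'I_n) :
    (forall u v, G u -> G v -> forall i : 'I_n, (v i < u i)%N ->
       exists j : 'I_n, (u j < v j)%N /\ G (u - U_(i) + U_(j))%MM) ->
    (forall u, G u -> ~ (u <= w)%MM) ->
    (forall i : 'I_n, exists2 u, G u & (u <= w + U_(i))%MM) ->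
  exists u, forall i : 'I_n, G (u + U_(i))%MM.
Proof.
move=> exch Gw Gwi.
(* A generator dividing [w x_i] but not w uses the additional factor [x_i]. *)
have lt_gen i g : G g -> (g <= w + U_(i))%MM -> (w i < g i)%N.
  move=> Gg /mnm_lepP gwi; rewrite ltnNge; apply/negP => gi.
  apply: (Gw _ Gg); apply/mnm_lepP => k; have := gwi k.
  by rewrite mnmDE mnm1E; case: eqP => [<-//|_]; rewrite addn0.
have [g Gg gw] := Gwi i0; have wg := lt_gen _ _ Gg gw.
exists (g - U_(i0))%MM => i; have [->|/eqP ii0] := eqVneq i i0.
  rewrite submK //; apply/mnm_lepP => k; rewrite mnm1E.
  by case: eqP => // <-; apply: leq_trans wg.
have [v Gv /mnm_lepP vw] := Gwi i.
have [|j [gv Gj]] := exch g v Gg Gv i0.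
  apply: leq_ltn_trans wg; have := vw i0; rewrite mnmDE mnm1E.
  by case: eqP => // _; rewrite addn0.
have [<-//|/eqP ji] := eqVneq j i.
exfalso; apply: (Gw _ Gj); apply/mnm_lepP => k.
have := mnm_lepP gw k; have := vw k; rewrite !mnmDE mnmBE !mnm1E.
by do 3 case: eqP => ? //=; subst=> //; lia.
Qed.

(** Since the class of f has annihilator m, some monomial w of f is outside I,
    and each [w x_i] is a monomial of [f x_i], hence in I.
    The index [i0] witnesses that there is a variable at all; without it the
    conclusion about u would be empty and would not determine the degree
    of u. It exists because a generator of I cannot divide w. *)
Lemma polymatroidal_socle (I : set {mpoly K[n]}) G :
    I = monomial_ideal G -> (exists u, G u) ->
    (forall u v, G u -> G v -> forall i : 'I_n, (v i < u i)%N ->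
       exists j : 'I_n, (u j < v j)%N /\ G (u - U_(i) + U_(j))%MM) ->
    Ass I (max_ideal K n) ->
  exists (i0 : 'I_n) u, forall i : 'I_n, G (u + U_(i))%MM.
Proof.
move=> -> [u0 Gu0] exch [[_ m1 _] [f mE]].
have mP g : max_ideal K n g <-> monomial_ideal G (g * f) by rewrite mE.
have nIf : ~ monomial_ideal G f by rewrite -[f]mul1r -mP.
have [w wf Gw] : exists2 w, w \in msupp f & forall u, G u -> ~ (u <= w)%MM.
  apply: contrapT => Hw; apply: nIf; apply/monomial_idealP => m mf.
  apply: contrapT => Hm; apply: Hw; exists m => // u Gu um.
  by apply: Hm; exists u.
have [i0 _] : exists i : 'I_n, (w i < u0 i)%N.
  apply: contrapT => Hi; apply: (Gw _ Gu0); apply/mnm_lepP => i.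
  by rewrite leqNgt; apply/negP => ?; apply: Hi; exists i.
exists i0; apply: (polymatroid_socle i0 exch Gw) => i.
have /mP/monomial_idealP : max_ideal K n 'X_i by apply: sub_ideal_gen; exists i.
by apply; rewrite mcoeff_msupp mulrC addmC mcoeffMX -mcoeff_msupp.
Qed.

Lemma polymatroidal_nonempty (I : set {mpoly K[n]}) G :
  I <> [set 0] -> I = monomial_ideal G -> exists u, G u.
Proof.
move=> I0 IE; apply: contrapT => G0; apply: I0.
rewrite IE; apply/seteqP; split=> [f /monomial_idealP Gf|_ ->]; last first.
  by apply/monomial_idealP => m; rewrite msupp0.
apply: msuppnil0; case: (msupp f) Gf => // m s Gf.
by have [|u Gu] := Gf m; [rewrite mem_head|case: G0; exists u].
Qed.

(** The witness is the class of [u v], where every [u x_i] is a generator of I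
    and v is a generator of J. *)
Lemma Ass_max_ideal_mul (I J : set {mpoly K[n]}) :
    polymatroidal I -> polymatroidal J -> Ass I (max_ideal K n) ->
  Ass (ideal_mul I J) (max_ideal K n).
Proof.
move=> [I0 [G [[IE _] [d dG] exch]]] [J0 [H [[JE _] [e eH] _]]] AssI.
have [v Hv] := polymatroidal_nonempty J0 JE.
have neG := polymatroidal_nonempty I0 IE.
have [i0 [u Gu]] := polymatroidal_socle IE neG exch AssI.
split; first by case: AssI.
exists 'X_[u + v]; rewrite IE JE ideal_mul_monomial; apply/seteqP; split.
  apply: ideal_gen_sub; first exact/is_ideal_colon/ideal_gen_is_ideal.
  move=> _ [i ->] /=; rewrite -mpolyXD; apply/monomial_idealX.
  exists (U_(i) + (u + v))%MM; last exact: lepm_refl.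
  by exists (u + U_(i))%MM => //; exists v => //; rewrite addmA (addmC u).
(* If g were outside the maximal ideal, cancelling it from [g u v] would put *)
(* [u v] in IJ, which its degree forbids. *)
move=> g /= Lg; apply: contrapT => mg.
have := monomial_ideal_cancel mg Lg.
move=> /monomial_idealX[_ [u' Gu' [v' Hv' <-]] le_uv].
have := dG _ (Gu i0); rewrite mdegD mdeg1 -(dG _ Gu') => eu.
have : (mdeg (u' + v') <= mdeg (u + v))%N.
  by rewrite !mdegE; apply: leq_sum => i _; apply: (mnm_lepP le_uv).
by rewrite !mdegD (eH _ Hv) (eH _ Hv') -eu; lia.
Qed.

End MonomialIdeals.

Theorem proposition5p7 (K : fieldType) (n : nat) (I J : set {mpoly K[n]})
    (hI : polymatroidal I) (hJ : polymatroidal J)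
    (hm : Ass I (max_ideal K n)) (k : nat) (hk : (1 <= k)%N) :
  symbolic_power (ideal_mul I J) k = ideal_exp (ideal_mul I J) k.
Proof.
apply: symbolic_power_id (Ass_max_ideal_mul hI hJ hm) _ => s f ms.
have [[_ [G [[-> _] _ _]]] [_ [H [[-> _] _ _]]]] := (hI, hJ).
rewrite ideal_mul_monomial.
set GH := [set _ | _ in _ & _ in _].
have [E ->] := ideal_exp_monomial (K := K) GH k.
exact: monomial_ideal_cancel.
Qed.
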